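(* Let $C\in\mathbb{R}^n$ be a given vector and let $f(x)=C^{T}G(x)$ for $x\in D$. Then the minimal-norm solution $u^{\dagger}$ of the degenerate kernel Fredholm integral equation $Lu=f$ is $$u^{\dagger}(t)=C^{T}H^{-1}H(t),\qquad t\in E,$$ and $$\|u^{\dagger}\|_{L^2(E)}^{2}=C^{T}H^{-1}C.$$
   Context: Let $D$ and $E$ be measurable subsets of Euclidean spaces, and let all functions be real-valued. Let $n\ge 1$, let $g_1,\dots,g_n\in L^2(D)$ be linearly independent and let $h_1,\dots,h_n\in L^2(E)$ be linearly independent. Write $G(x)=(g_1(x),\dots,g_n(x))^{T}$ and $H(t)=(h_1(t),\dots,h_n(t))^{T}$. Define the operator $L$ on $L^2(E)$ by $$L(u)(x)=\int_E k(x,t)u(t)\,dt,\qquad k(x,t)=\sum_{i=1}^{n}g_i(x)h_i(t)=G(x)^{T}H(t),\quad x\in D.$$ The symbol $H$ without an argument denotes the $n\times n$ matrix $H=[h_{ij}]$ with $h_{ij}=\int_E h_i(t)h_j(t)\,dt$ (as opposed to the vector function $H(t)$). For $f\in L^2(D)$, a function $u\in L^2(E)$ is a least-squares solution of $Lu=f$ if $\|Lu-f\|_{L^2(D)}=\inf\{\|Lv-f\|_{L^2(D)}: v\in L^2(E)\}$. With $S$ the set of least-squares solutions, the minimal-norm solution of $Lu=f$ is the element $u^{\dagger}\in S$ with $\|u^{\dagger}\|_{L^2(E)}=\inf_{u\in S}\|u\|_{L^2(E)}$. *)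

(* Defs.v *)
From HB Require Import structures.
From mathcomp Require Import all_boot all_order all_algebra.
From mathcomp Require Import all_classical all_reals all_analysis.
Set Implicit Arguments.
Unset Strict Implicit.
Unset Printing Implicit Defensive.
Import Order.TTheory GRing.Theory Num.Theory.
Import numFieldNormedType.Exports.
Local Open Scope classical_set_scope.
Local Open Scope ring_scope.

(* Lebesgue outer measure on R^(p+1), by countable covers with half-open boxes.
   The dimension is a successor because in dimension 0 every box is the whole
   space, so that no cover of the empty set would have total volume 0. *)
Section lebesgue_outer.
Context {R : realType} {p : nat}.
Local Notation V := 'rV[R]_p.+1.

Definition box (ab : V * V) : set V :=
  [set x | forall i, ab.1 0 i < x 0 i <= ab.2 0 i].

Definition box_volume (ab : V * V) : \bar R :=
  (\prod_i Num.max 0 (ab.2 0 i - ab.1 0 i))%:E.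

Definition box_cover (A : set V) : set (nat -> V * V) :=
  [set B | A `<=` \bigcup_k box (B k)].

Definition lebesgue_outer (A : set V) : \bar R :=
  ereal_inf [set (\sum_(k <oo) box_volume (B k))%E | B in box_cover A].

Lemma box_volume_ge0 ab : (0 <= box_volume ab)%E.
Proof. by rewrite lee_fin prodr_ge0// => i _; rewrite le_max lexx. Qed.

Lemma lebesgue_outer_ge0 A : (0 <= lebesgue_outer A)%E.
Proof.
apply: le_ereal_inf_tmp => _ [B _ <-].
by apply: nneseries_ge0 => k _ _; exact: box_volume_ge0.
Qed.

Lemma lebesgue_outer0 : lebesgue_outer set0 = 0%E.
Proof.
apply/eqP; rewrite eq_le lebesgue_outer_ge0 andbT.
apply: ereal_inf_lbound; exists (fun=> (0, 0)); first by [].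
apply: eseries0 => k _ _; congr EFin.
by rewrite (bigD1 ord0)//= !mxE subrr maxxx mul0r.
Qed.

Lemma le_lebesgue_outer :
  {homo lebesgue_outer : A B / A `<=` B >-> (A <= B)%E}.
Proof.
move=> A B AB; apply: ereal_inf_le_tmp => _ [F BF <-]; exists F => //.
exact: subset_trans AB BF.
Qed.

Lemma lebesgue_outer_sigma_subadditive : sigma_subadditive lebesgue_outer.
Proof.
move=> A; have [[i ioo]|] := pselect (exists i, lebesgue_outer (A i) = +oo%E).
  rewrite (eseries_pinfty _ _ ioo) ?leey// => n _.
  by rewrite -ltNye (lt_le_trans _ (lebesgue_outer_ge0 _)).
rewrite -forallNE => Aoo; apply/lee_addgt0Pr => e e0.
rewrite (le_trans _ (epsilon_trick _ _ (ltW e0)))//; last first.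
  by move=> n; exact: lebesgue_outer_ge0.
pose P n (B : nat -> V * V) := box_cover (A n) B /\
  (\sum_(k <oo) box_volume (B k) <=
     lebesgue_outer (A n) + (e / (2 ^ n.+1)%:R)%:E)%E.
have [G PG] : {G : nat -> nat -> V * V & forall n, P n (G n)}.
  apply: (@choice _ _ P) => n.
  have en : 0 < e / (2 ^ n.+1)%:R by rewrite divr_gt0// ltr0n expn_gt0.
  have fin : lebesgue_outer (A n) \is a fin_num.
    by rewrite ge0_fin_numE ?lebesgue_outer_ge0// ltey; exact/eqP/Aoo.
  have [_ [B AB <-] lB] := lb_ereal_inf_adherent en fin.
  by exists B; split => //; exact: ltW.
have G_ge0 x : (0 <= (box_volume \o uncurry G) x)%E by exact: box_volume_ge0.
apply: (@le_trans _ _ (\esum_(i in setT) (box_volume \o uncurry G) i)%E).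
  apply: ereal_inf_lbound => /=.
  have /card_esym/ppcard_eqP[f] := card_nat2.
  exists (uncurry G \o f).
    move=> t [i _] /(PG i).1[j _ Bt]; exists (f^-1%FUN (i, j)) => //=.
    by rewrite invK ?inE.
  rewrite -(esum_pred_image (box_volume \o uncurry G) _ xpredT)
    ?[fun=> _]set_true//.
  by rewrite image_eq.
rewrite (_ : esum _ _ = \sum_(i <oo) \sum_(j <oo) box_volume (G i j))%E.
  apply: lee_nneseries => n *; last exact: (PG n).2.
  by apply: nneseries_ge0 => m *; exact: (G_ge0 (n, m)).
pose J : nat -> set (nat * nat) := fun i => [set (i, j) | j in setT].
rewrite (_ : setT = \bigcup_k J k); last first.
  by rewrite predeqE => -[a b]; split => // _; exists a => //; exists b.
rewrite esum_bigcupT /=; last 2 first.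
- apply/trivIsetP => i j _ _ ij.
  rewrite predeqE => -[n m] /=; split => //= -[] [_] _ [<-{n} _].
  by move=> [m' _] [] /esym/eqP; rewrite (negbTE ij).
- by move=> /= [n m]; exact: box_volume_ge0.
rewrite -(image_id [set: nat]) -fun_true esum_pred_image//; last first.
  by move=> n _; apply: esum_ge0 => m _; exact: box_volume_ge0.
apply: eq_eseriesr => /= j _.
rewrite -(esum_pred_image (box_volume \o uncurry G) (pair j) predT)//=.
- by congr esum; rewrite predeqE => -[a b]; split; move=> [i _ <-]; exists i.
- by move=> m _; exact: box_volume_ge0.
- by move=> ? ? _ _; exact: (@can_inj _ _ _ snd).
Qed.

HB.instance Definition _ := isOuterMeasure.Build R V lebesgue_outer
  lebesgue_outer0 lebesgue_outer_ge0 le_lebesgue_outer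
  lebesgue_outer_sigma_subadditive.

End lebesgue_outer.

(* R^(p+1) with the sigma-algebra of its Lebesgue measurable sets. *)
Definition euclidean (R : realType) (p : nat) : Type :=
  caratheodory_type (@lebesgue_outer R p : {outer_measure set _ -> \bar R}).

HB.instance Definition _ (R : realType) (p : nat) :=
  Measurable.copy (euclidean R p)
    (caratheodory_type (@lebesgue_outer R p : {outer_measure set _ -> \bar R})).

Definition lebesgue (R : realType) (p : nat) : set (euclidean R p) -> \bar R :=
  @lebesgue_outer R p.

Section lebesgue_measure_instance.
Context (R : realType) (p : nat).

Let lebesgue0 : @lebesgue R p set0 = 0%E.
Proof. exact: lebesgue_outer0. Qed.

Let lebesgue_ge0 A : (0 <= @lebesgue R p A)%E.
Proof. exact: lebesgue_outer_ge0. Qed.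

Let lebesgue_sigma_additive : semi_sigma_additive (@lebesgue R p).
Proof. by move=> F mF tF mUF; exact: caratheodory_measure_sigma_additive. Qed.

HB.instance Definition _ := isMeasure.Build _ _ _ (@lebesgue R p)
  lebesgue0 lebesgue_ge0 lebesgue_sigma_additive.

End lebesgue_measure_instance.

(* L^2(D) is L^2 of the Lebesgue measure restricted to D: its elements are
   represented by functions on the whole space, whose values off D do not
   matter since the complement of D is negligible. *)
Definition lebesgue_on (R : realType) (p : nat) (D : set (euclidean R p))
    (mD : measurable D) : {measure set (euclidean R p) -> \bar R} :=
  mrestr (@lebesgue R p) mD.

Section degenerate_kernel.
Context {R : realType} {d1 d2 : measure_display}.
Context {T1 : measurableType d1} {T2 : measurableType d2}.
Variables (mu : {measure set T1 -> \bar R}) (nu : {measure set T2 -> \bar R}).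

Definition lin_indep n (g : 'I_n -> T1 -> R) : Prop :=
  forall c : 'I_n -> R,
    (fun x => \sum_i c i * g i x) = (fun=> 0) %[ae mu] -> forall i, c i = 0.

Definition fun_vec T n (g : 'I_n -> T -> R) (x : T) : 'cV[R]_n :=
  \col_i g i x.

Definition degenerate_kernel n (g : 'I_n -> T1 -> R) (h : 'I_n -> T2 -> R)
    (x : T1) (t : T2) : R :=
  \sum_i g i x * h i t.

Definition integral_operator (k : T1 -> T2 -> R) (u : T2 -> R) : T1 -> R :=
  fun x => \int[nu]_t (k x t * u t).

Definition gram_matrix n (h : 'I_n -> T2 -> R) : 'M[R]_n :=
  \matrix_(i, j) \int[nu]_t (h i t * h j t).

Variables (L : (T2 -> R) -> T1 -> R) (f : T1 -> R).

Definition residual_norm (u : T2 -> R) : \bar R :=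
  'N[mu]_2%:E[EFin \o (L u \- f)%R]%E.

Definition least_squares_solution (u : T2 -> R) : Prop :=
  u \in Lfun nu 2%:E /\
  residual_norm u = ereal_inf [set residual_norm v | v in [set` Lfun nu 2%:E]].

Definition minimal_norm_solution (u : T2 -> R) : Prop :=
  least_squares_solution u /\
  ('N[nu]_2%:E[EFin \o u] =
   ereal_inf [set 'N[nu]_2%:E[EFin \o v] | v in least_squares_solution])%E.

End degenerate_kernel.

(* Main.v *)
Require Import Defs.
From mathcomp Require Import all_boot all_order all_algebra.
From mathcomp Require Import all_classical all_reals all_analysis.
From mathcomp Require Import measurable_realfun ring.
Set Implicit Arguments.
Unset Strict Implicit.
Unset Printing Implicit Defensive.
Import Order.TTheory GRing.Theory Num.Theory.
Import numFieldNormedType.Exports.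
Local Open Scope classical_set_scope.
Local Open Scope ring_scope.

(** The operator sees [u] only through its moments: [L u] is the combination of
    the [g i] with coefficients [\int h_i u].  Since [f] is the combination with
    coefficients [C] and the [g i] are independent, the residual of [u] vanishes
    exactly when its moments are those prescribed by [C].  The candidate
    [u_dag], the combination of the [h i] with coefficients [C^T H^-1], has
    moments [C^T H^-1 H = C^T], so the infimum of the residual is 0 and is
    attained: the least-squares solutions are exactly the square-integrable
    functions with moments [C] ([least_squares_solution_moments]).

    On that set the inner product with [u_dag] is constant, because [u_dag] lies
    in the span of the [h i]: it equals [C^T H^-1 C].  Taking [u_dag] itself as
    the other factor gives its squared norm.  Taking any least-squares solution
    [u] shows that [u - u_dag] is orthogonal to [u_dag], so that
    [|u|^2 = |u_dag|^2 + |u - u_dag|^2] ([Rintegral_sqr_Pythagoras]).  Hence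
    [u_dag] has minimal norm, and equality of the norms forces [u = u_dag] almost
    everywhere.

    The matrix [H] is invertible because a vector [a] in its kernel yields a
    combination [w] of the [h i] orthogonal to every [h i], hence to itself; so
    [w] vanishes almost everywhere and [a = 0] ([gram_matrix_unitmx]). *)

Section square_integrable.
Context {R : realType} {d : measure_display} {T : measurableType d}.
Variable mu : {measure set T -> \bar R}.
Implicit Types u v w : T -> R.
Local Notation L2 := (Lfun mu 2%:E).

Lemma Lfun2_integrableM u v : u \in L2 -> v \in L2 ->
  mu.-integrable [set: T] (EFin \o (fun t => u t * v t)).
Proof. by move=> uL2 vL2; exact/Lfun1_integrable/Lfun2_mul_Lfun1. Qed.

Let L2_submod : submod_closed L2.
Proof. by apply: Lfun_submod_closed; rewrite lee1n. Qed.

Lemma Lfun2B u v : u \in L2 -> v \in L2 -> (fun t => u t - v t) \in L2.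
Proof.
move=> uL2 vL2; rewrite (_ : (fun t => _) = -1 *: v + u); last first.
  by apply/funext => t; rewrite fctE/= scaleN1r addrC.
exact: L2_submod.2.
Qed.

Lemma Lfun2_lin_comb n (a : 'I_n -> R) (h : 'I_n -> T -> R) :
  (forall i, h i \in L2) -> (fun t => \sum_i a i * h i t) \in L2.
Proof.
move=> hL2; rewrite (_ : (fun t => _) = \sum_i (a i *: h i)); last first.
  by apply/funext => t; rewrite fct_sumE.
apply: (big_ind (fun u => u \in L2)) => [|u v uL2 vL2|i _].
- exact: L2_submod.1.
- by rewrite -[u]scale1r; exact: L2_submod.2.
- by rewrite -[X in X \in _]addr0; apply: L2_submod.2 => //; exact: L2_submod.1.
Qed.

Lemma Rintegral_lin_combM n (a : 'I_n -> R) (h : 'I_n -> T -> R) v :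
  (forall i, h i \in L2) -> v \in L2 ->
  \int[mu]_t ((\sum_i a i * h i t) * v t) =
  \sum_i a i * \int[mu]_t (h i t * v t).
Proof.
move=> hL2 vL2; have ihv i := Lfun2_integrableM (hL2 i) vL2.
have fineE i : (\int[mu]_t (h i t * v t)%:E = (\int[mu]_t (h i t * v t))%:E)%E.
  by rewrite fineK//; exact: (integrable_fin_num _ (ihv i)).
rewrite {1}/Rintegral.
under eq_integral => t _.
  rewrite mulr_suml -sumEFin.
  under eq_bigr do rewrite -mulrA EFinM.
  over.
rewrite integral_sum//; last first.
  by move=> i; apply: integrableZl => //; exact: ihv.
under eq_bigr => i _ do rewrite (integralZl _ (ihv i))//= fineE -EFinM.
by rewrite sumEFin.
Qed.

(** Comparing and equating norms reduces to real-valued integrals of squares. *)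
Lemma Lnorm2E u : u \in L2 ->
  'N[mu]_2%:E[EFin \o u]%E = (Num.sqrt (\int[mu]_t (u t * u t)))%:E.
Proof.
move=> uL2; rewrite unlock /Lnorm.
under eq_integral => t _.
  rewrite /= powR_mulrn// real_normK ?num_real// expr2; over.
rewrite -[X in (X `^ _)%E]fineK; last first.
  exact: integrable_fin_num (Lfun2_integrableM uL2 uL2).
by rewrite poweR_EFin powR12_sqrt// Rintegral_ge0// => t _; rewrite -expr2 sqr_ge0.
Qed.

Lemma Rintegral_sqr_ge0 u : 0 <= \int[mu]_t (u t * u t).
Proof. by apply: Rintegral_ge0 => t _; rewrite -expr2 sqr_ge0. Qed.

Lemma Rintegral_sqr_eq0 u : u \in L2 -> \int[mu]_t (u t * u t) = 0 ->
  u = (fun=> 0) %[ae mu].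
Proof.
move=> uL2 u0.
have /measurable_EFinP mu_u : measurable_fun [set: T] u.
  exact: set_mem (sub_Lfun_mfun uL2).
have p0 : (0 < 2%:E :> \bar R)%E by rewrite lte_fin ltr0n.
have := Lnorm_eq0_eq0 (mu := mu) mu_u p0.
rewrite Lnorm2E// u0 sqrtr0 => /(_ erefl).
by apply: filterS => t /(_ I) [].
Qed.

(** The hypothesis on the inner products says that [w] is orthogonal to [v - w],
    so the cross term of the expansion of [v = w + (v - w)] vanishes. *)
Lemma Rintegral_sqr_Pythagoras v w : v \in L2 -> w \in L2 ->
  \int[mu]_t (w t * v t) = \int[mu]_t (w t * w t) ->
  \int[mu]_t (v t * v t) =
  \int[mu]_t (w t * w t) + \int[mu]_t ((v t - w t) * (v t - w t)).
Proof.
move=> vL2 wL2 wv.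
have iww := Lfun2_integrableM wL2 wL2.
have iwv := Lfun2_integrableM wL2 vL2.
have vwL2 := Lfun2B vL2 wL2.
have iBB := Lfun2_integrableM vwL2 vwL2.
have iwB := Lfun2_integrableM wL2 vwL2.
have wB0 : \int[mu]_t (w t * (v t - w t)) = 0.
  under eq_Rintegral do rewrite mulrBr.
  by rewrite RintegralB// wv subrr.
under eq_Rintegral => t _.
  rewrite (_ : v t * v t = w t * w t + (2 * (w t * (v t - w t)) +
    (v t - w t) * (v t - w t))); last by ring.
  over.
have i2wB : mu.-integrable setT (EFin \o (fun t => 2 * (w t * (v t - w t)))).
  exact: (integrableZl measurableT 2 iwB).
rewrite RintegralD//; last exact: (integrableD measurableT i2wB iBB).
by rewrite RintegralD// RintegralZl// wB0 mulr0 add0r.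
Qed.

(** If [a H = 0], the combination of the [h i] with coefficients [a] is orthogonal
    to each [h i], hence to itself, and independence gives [a = 0]. *)
Lemma gram_matrix_unitmx n (h : 'I_n -> T -> R) :
  (forall i, h i \in L2) -> lin_indep mu h -> gram_matrix mu h \in unitmx.
Proof.
move=> hL2 hfree; rewrite -row_free_unit; apply: inj_row_free => a aH0.
pose w t := \sum_i a 0 i * h i t.
have wL2 : w \in L2 by exact: Lfun2_lin_comb.
have w0 : \int[mu]_t (w t * w t) = 0.
  rewrite Rintegral_lin_combM// big1// => i _.
  under eq_Rintegral do rewrite mulrC.
  rewrite Rintegral_lin_combM//.
  have /rowP/(_ i) := aH0; rewrite !mxE.
  by under eq_bigr do rewrite mxE; move=> ->; rewrite mulr0.
apply/rowP => i; rewrite mxE.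
exact: (hfree (a 0) (Rintegral_sqr_eq0 wL2 w0)).
Qed.

End square_integrable.

Section degenerate_least_squares.
Context {R : realType} {d1 d2 : measure_display}.
Context {T1 : measurableType d1} {T2 : measurableType d2}.
Variables (mu : {measure set T1 -> \bar R}) (nu : {measure set T2 -> \bar R}).
Variables (n : nat) (g : 'I_n -> T1 -> R) (h : 'I_n -> T2 -> R).
Hypothesis gL2 : forall i, g i \in Lfun mu 2%:E.
Hypothesis hL2 : forall i, h i \in Lfun nu 2%:E.
Hypothesis g_indep : lin_indep mu g.

Local Notation L := (integral_operator nu (degenerate_kernel g h)).

Lemma integral_operator_degenerateE u x : u \in Lfun nu 2%:E ->
  L u x = \sum_i (\int[nu]_t (h i t * u t)) * g i x.
Proof.
move=> uL2; rewrite /integral_operator /degenerate_kernel.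
by rewrite Rintegral_lin_combM//; apply: eq_bigr => i _; rewrite mulrC.
Qed.

(** The residual is the combination of the [g i] whose coefficients are the
    defects [\int h_i u - c_i], so independence of the [g i] applies to it. *)
Lemma residual_norm_eq0 (c : 'I_n -> R) u : u \in Lfun nu 2%:E ->
  residual_norm mu L (fun x => \sum_i c i * g i x) u = 0%E <->
  forall i, \int[nu]_t (h i t * u t) = c i.
Proof.
move=> uL2; pose e i := \int[nu]_t (h i t * u t) - c i.
have rE : L u \- (fun x => \sum_i c i * g i x) =
    (fun x => \sum_i e i * g i x).
  apply/funext => x /=; rewrite integral_operator_degenerateE//.
  by rewrite -sumrB; apply: eq_bigr => i _; rewrite mulrBl.
rewrite /residual_norm rE; split => [r0 i|uc]; last first.
  rewrite (_ : (fun x => _) = cst 0) ?Lnorm0//.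
  by apply/funext => x; rewrite big1// => i _; rewrite /e uc subrr mul0r.
have eL2 := Lfun2_lin_comb e gL2.
move: r0; rewrite Lnorm2E// => -[] /eqP.
rewrite sqrtr_eq0 => rle0; apply/eqP; rewrite -subr_eq0; apply/eqP.
apply: (g_indep (c := e)); apply: Rintegral_sqr_eq0 => //.
by apply/eqP; rewrite eq_le rle0 Rintegral_sqr_ge0.
Qed.

(** The witness [w] is what makes the infimum of the residual equal to 0; without
    a function having the prescribed moments, that infimum could be positive. *)
Lemma least_squares_solution_moments (c : 'I_n -> R) w u :
  w \in Lfun nu 2%:E -> (forall i, \int[nu]_t (h i t * w t) = c i) ->
  least_squares_solution mu nu L (fun x => \sum_i c i * g i x) u <->
  u \in Lfun nu 2%:E /\ forall i, \int[nu]_t (h i t * u t) = c i.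
Proof.
move=> wL2 wc; rewrite /least_squares_solution; set r := residual_norm _ _ _.
have inf0 : ereal_inf [set r v | v in [set` Lfun nu 2%:E]] = 0%E.
  apply/eqP; rewrite eq_le; apply/andP; split.
    by apply: ereal_inf_lbound; exists w => //; exact/residual_norm_eq0.
  by apply: le_ereal_inf_tmp => _ [v _ <-]; exact: Lnorm_ge0.
by rewrite inf0; split => -[uL2 /residual_norm_eq0]; auto.
Qed.

End degenerate_least_squares.

Theorem corollary1 (R : realType) (p q : nat)
    (D : set (euclidean R p)) (E : set (euclidean R q))
    (mD : measurable D) (mE : measurable E)
    (n : nat) (n_ge1 : (1 <= n)%N)
    (g : 'I_n -> euclidean R p -> R) (h : 'I_n -> euclidean R q -> R)
    (gL2 : forall i, g i \in Lfun (lebesgue_on mD) 2%:E)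
    (hL2 : forall i, h i \in Lfun (lebesgue_on mE) 2%:E)
    (g_indep : lin_indep (lebesgue_on mD) g)
    (h_indep : lin_indep (lebesgue_on mE) h)
    (C : 'cV[R]_n) :
  let L := integral_operator (lebesgue_on mE) (degenerate_kernel g h) in
  let f := fun x => (C^T *m fun_vec g x) 0 0 in
  let H := gram_matrix (lebesgue_on mE) h in
  let u_dag := fun t => (C^T *m invmx H *m fun_vec h t) 0 0 in
  [/\ H \in unitmx,
      minimal_norm_solution (lebesgue_on mD) (lebesgue_on mE) L f u_dag,
      (forall u, minimal_norm_solution (lebesgue_on mD) (lebesgue_on mE) L f u ->
         u = u_dag %[ae lebesgue_on mE]) &
      ('N[lebesgue_on mE]_2%:E[EFin \o u_dag] ^+ 2 =
       ((C^T *m invmx H *m C) 0 0)%:E)%E].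
Proof.
move=> L f H u_dag; have Hunit : H \in unitmx by exact: gram_matrix_unitmx.
pose c i := C i 0; pose a i := (C^T *m invmx H) 0 i.
have fE : f = fun x => \sum_i c i * g i x.
  by apply/funext => x; rewrite /f mxE; apply: eq_bigr => i _; rewrite !mxE.
have u_dagE : u_dag = fun t => \sum_i a i * h i t.
  apply/funext => t; rewrite /u_dag mxE; apply: eq_bigr => i _.
  by rewrite [fun_vec _ _ _ _]mxE.
have udL2 : u_dag \in Lfun (lebesgue_on mE) 2%:E.
  by rewrite u_dagE; exact: Lfun2_lin_comb.
have ud_moments i : \int[lebesgue_on mE]_t (h i t * u_dag t) = c i.
  under eq_Rintegral do rewrite mulrC u_dagE.
  rewrite Rintegral_lin_combM//.
  have : (C^T *m invmx H *m H) 0 i = c i by rewrite mulmxKV// mxE.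
  by rewrite mxE => <-; apply: eq_bigr => j _; rewrite [H j i]mxE.
have ud_dot v : v \in Lfun (lebesgue_on mE) 2%:E ->
    (forall i, \int[lebesgue_on mE]_t (h i t * v t) = c i) ->
    \int[lebesgue_on mE]_t (u_dag t * v t) = (C^T *m invmx H *m C) 0 0.
  move=> vL2 vc; rewrite u_dagE Rintegral_lin_combM// mxE.
  by apply: eq_bigr => i _; rewrite vc.
have lsP u := least_squares_solution_moments gL2 hL2 g_indep u udL2 ud_moments.
have Pyth u : least_squares_solution (lebesgue_on mD) (lebesgue_on mE) L f u ->
    \int[lebesgue_on mE]_t (u t * u t) =
    \int[lebesgue_on mE]_t (u_dag t * u_dag t) +
    \int[lebesgue_on mE]_t ((u t - u_dag t) * (u t - u_dag t)).
  rewrite fE => /lsP[uL2 uc].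
  by apply: Rintegral_sqr_Pythagoras => //; rewrite (ud_dot u)// (ud_dot u_dag).
have ud_ls : least_squares_solution (lebesgue_on mD) (lebesgue_on mE) L f u_dag.
  by rewrite fE; apply/lsP.
have ls_L2 u : least_squares_solution (lebesgue_on mD) (lebesgue_on mE) L f u ->
    u \in Lfun (lebesgue_on mE) 2%:E by case.
have ud_min : minimal_norm_solution (lebesgue_on mD) (lebesgue_on mE) L f u_dag.
  split=> //; apply/eqP; rewrite eq_le; apply/andP; split; last first.
    by apply: ereal_inf_lbound; exists u_dag.
  apply: le_ereal_inf_tmp => _ [v v_ls <-].
  rewrite !Lnorm2E ?ls_L2// lee_fin ler_wsqrtr// [leRHS]Pyth//.
  by rewrite lerDl Rintegral_sqr_ge0.
split=> // [u [u_ls u_min]|].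
  have uL2 := ls_L2 _ u_ls.
  have : \int[lebesgue_on mE]_t ((u t - u_dag t) * (u t - u_dag t)) = 0.
    have := u_min; rewrite -ud_min.2 !Lnorm2E// => -[] /eqP.
    rewrite eqr_sqrt ?Rintegral_sqr_ge0// (Pyth u)//.
    by rewrite -[eqbRHS]addr0 (inj_eq (addrI _)) => /eqP.
  move/(Rintegral_sqr_eq0 (Lfun2B uL2 udL2)).
  by apply: filterS => t /[apply] /eqP; rewrite subr_eq0 => /eqP.
rewrite Lnorm2E// ud_dot// -EFin_expe sqr_sqrtr//.
by rewrite -(ud_dot _ udL2 ud_moments) Rintegral_sqr_ge0.
Qed.
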